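(* For every DAG $G$ and every positive integer $r$, $$\mathrm{OPT}_{PRBP}(G,r)\ \ge\ r\cdot\left(\mathrm{MIN}_{dom}(2r)-1\right).$$
   Context: All DAGs $G=(V,E)$ are finite and have no isolated nodes. Sources are nodes of in-degree 0, sinks are nodes of out-degree 0. The integer $r$ is the fast memory capacity. Partial-computing red-blue pebble game (PRBP, one-shot). There are blue, light red and dark red pebbles, and edges can be marked. Initially exactly the sources carry blue pebbles, there are no other pebbles, and all edges are unmarked. Moves: (1) Save: replace a dark red pebble on a node by a blue and a light red pebble. (2) Load: place a light red pebble on a node that has a blue pebble. (3) Partial compute: for an unmarked edge $(u,v)$ such that (i) all incoming edges of $u$ are marked, (ii) $u$ has a (light or dark) red pebble, and (iii) $v$ has a (light or dark) red pebble or no pebble at all, replace all pebbles on $v$ by one dark red pebble and mark $(u,v)$ (each edge is marked at most once and never unmarked). (4) Delete: remove a light red pebble from any node, or remove a dark red pebble from a non-sink node all of whose outgoing edges are marked. At every time the total number of (light and dark) red pebbles is at most $r$. A pebbling is a sequence of moves after which every sink has a blue pebble and every edge is marked. Its cost is the total number of save and load moves, and $\mathrm{OPT}_{PRBP}(G,r)$ is the minimum cost of a pebbling of $G$ with capacity $r$ ($+\infty$ if none exists; one exists whenever $r\ge 2$). $S$-dominator partitions. For $V_0\subseteq V$, a set $D\subseteq V$ is a dominator for $V_0$ if every directed path that starts at a source and ends in a node of $V_0$ contains a node of $D$ (paths consisting of a single node are included). For a positive integer $S$, an $S$-dominator partition of $G$ is a partition of $V$ into disjoint classes $V_1,\dots,V_k$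 such that: (i) if $u\in V_i$ and $v\in V_j$ with $i>j$, then $(u,v)\notin E$; (ii) each $V_i$ has a dominator of size at most $S$. $\mathrm{MIN}_{dom}(S)$ is the minimum number of classes of any $S$-dominator partition of $G$. *)

(* Defs.v *)
From mathcomp Require Import all_boot all_order all_algebra.
From mathcomp Require Import boolp constructive_ereal.

Set Implicit Arguments.
Unset Strict Implicit.
Unset Printing Implicit Defensive.

(* The minimum of a set of natural numbers, with min set0 = +oo. The values
   are taken in \bar int so that 1 can be subtracted without truncation. *)
Definition min_nat (P : nat -> Prop) : \bar int :=
  match pselect (exists n, `[< P n >]) with
  | left exP => (Posz (ex_minn exP))%:E%E
  | right _ => +oo%E
  end.

Section Dag.
Variables (V : finType) (e : rel V).

Definition acyclic := forall c : seq V, cycle e c -> c = [::].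

Definition no_isolated := forall v : V, exists u : V, e u v \/ e v u.

Definition is_source (v : V) := [forall u, ~~ e u v].
Definition is_sink (v : V) := [forall w, ~~ e v w].

Definition dominator (D V0 : {set V}) :=
  forall (x : V) (p : seq V),
    is_source x -> path e x p -> last x p \in V0 -> has (mem D) (x :: p).

(* The classes V_1, ..., V_k are the successive items of Vs; [partition] makes
   them nonempty, which does not affect their minimum number. *)
Definition dominator_partition (S : nat) (Vs : seq {set V}) :=
  [/\ uniq Vs,
      partition [set:: Vs] [set: V],
      forall i j u v, j < i < size Vs ->
        u \in nth set0 Vs i -> v \in nth set0 Vs j -> ~~ e u v
    & forall W, W \in Vs -> exists2 D : {set V}, #|D| <= S & dominator D W].

Definition MIN_dom (S : nat) : \bar int :=
  min_nat (fun k => exists2 Vs, dominator_partition S Vs & size Vs = k).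

(* Pebbles of each colour form a set: a node carries at most one pebble of a
   given colour, so loading a node that is already light red costs 1 but does
   not change the state. *)
Record state := State {
  blue : {set V};
  light : {set V};
  dark : {set V};
  marked : {set V * V} }.

Definition red (s : state) : {set V} := light s :|: dark s.

Definition num_red (s : state) : nat := #|light s| + #|dark s|.

Definition init : state := State [set v | is_source v] set0 set0 set0.

Inductive move :=
  | MSave of V
  | MLoad of V
  | MCompute of V & V
  | MDeleteLight of V
  | MDeleteDark of V.

Definition in_marked (s : state) (v : V) :=
  [forall u, e u v ==> ((u, v) \in marked s)].
Definition out_marked (s : state) (v : V) :=
  [forall w, e v w ==> ((v, w) \in marked s)].

Definition legal (s : state) (m : move) : bool :=
  match m with
  | MSave v => v \in dark s
  | MLoad v => v \in blue s
  | MCompute u v =>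
      [&& e u v, (u, v) \notin marked s, in_marked s u, u \in red s
        & (v \in red s) || (v \notin blue s :|: red s)]
  | MDeleteLight v => v \in light s
  | MDeleteDark v => [&& v \in dark s, ~~ is_sink v & out_marked s v]
  end.

Definition apply_move (s : state) (m : move) : state :=
  match m with
  | MSave v => State (v |: blue s) (v |: light s) (dark s :\ v) (marked s)
  | MLoad v => State (blue s) (v |: light s) (dark s) (marked s)
  | MCompute u v =>
      State (blue s :\ v) (light s :\ v) (v |: dark s) ((u, v) |: marked s)
  | MDeleteLight v => State (blue s) (light s :\ v) (dark s) (marked s)
  | MDeleteDark v => State (blue s) (light s) (dark s :\ v) (marked s)
  end.

Fixpoint legal_seq (r : nat) (s : state) (ms : seq move) : bool :=
  (num_red s <= r) &&
  (if ms is m :: ms' then legal s m && legal_seq r (apply_move s m) ms'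
   else true).

Definition terminal (s : state) :=
  (forall v, is_sink v -> v \in blue s) /\
  (forall u v, e u v -> (u, v) \in marked s).

Definition pebbling (r : nat) (ms : seq move) :=
  legal_seq r init ms /\ terminal (foldl apply_move init ms).

Definition is_io (m : move) : bool :=
  match m with MSave _ | MLoad _ => true | _ => false end.

Definition cost (ms : seq move) : nat := count is_io ms.

Definition OPT_PRBP (r : nat) : \bar int :=
  min_nat (fun c => exists2 ms, pebbling r ms & cost ms = c).

End Dag.

(* Main.v *)
(** Cut a pebbling of cost [c] into consecutive segments, each (but the last)
    containing exactly [r] I/O moves. Let [D] be the set of nodes that are red
    at the start of a segment or loaded during it, so [#|D| <= 2 * r]. Assign a
    non-source to the segment where its last in-edge gets marked, and a source
    to the segment where its first out-edge gets marked. Marking the edge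
    [(u, v)] requires [u] to be complete, so no edge goes back to an earlier
    segment. The set [D] dominates the nodes assigned to the segment: walking a
    source path backwards from such a node while staying outside [D], every
    node met is red at some time of the segment, hence was computed in it; had
    one of its in-edges been marked before, the node would carry only a blue
    pebble at the start of the segment and need a load. So all its in-edges are
    marked within the segment and the walk goes on, down to a source, which is
    red only if it belongs to [D]. *)
Require Import Defs.
From mathcomp Require Import all_boot all_order all_algebra.
From mathcomp Require Import boolp constructive_ereal.
From mathcomp Require Import zify.

Set Implicit Arguments.
Unset Strict Implicit.
Unset Printing Implicit Defensive.

(** * Invariants of reachable states *)

Section Pebbling.
Variables (V : finType) (e : rel V).
Implicit Types (s t : state V) (m : move V) (ms : seq (move V)).
Implicit Types (u v w : V) (D W : {set V}).

(** [partially_marked] says that partial values are never lost. Deleting a light red pebble is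
    harmless because of [light_blue]. *)
Record reachable_inv s : Prop := ReachableInv {
  marked_edge : forall u v, (u, v) \in marked s -> e u v;
  marked_tail : forall u v, (u, v) \in marked s -> in_marked e s u;
  light_blue : light s \subset blue s;
  partially_marked : forall u v, (u, v) \in marked s -> ~~ in_marked e s v ->
    v \in blue s :|: red s }.

Lemma in_markedP s v :
  reflect (forall u, e u v -> (u, v) \in marked s) (in_marked e s v).
Proof. by apply: (iffP forallP) => H u; apply/implyP; exact: H. Qed.

Lemma in_marked_mono s t v : marked s \subset marked t ->
  in_marked e s v -> in_marked e t v.
Proof. by move=> /subsetP st /in_markedP sv; apply/in_markedP => u /sv/st. Qed.

Lemma reachable_inv_init : reachable_inv (init e).
Proof. by split=> [u v|u v||u v] /=; rewrite ?sub0set ?in_set0. Qed.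

Lemma marked_apply_move s m : marked s \subset marked (apply_move s m).
Proof. by case: m => //= u v; apply: subsetUr. Qed.

Lemma reachable_inv_move s m :
  reachable_inv s -> legal e s m -> reachable_inv (apply_move s m).
Proof.
case=> sE sT sL sP; have /subsetP sLv := sL.
case: m => [v|v|u v|v|v] /= legm; split=> //=.
- exact: setUS.
- move=> x y xy; rewrite -/(in_marked e s y) => /(sP _ _ xy).
  by rewrite !inE; case: eqP => //= _; case/or3P => ->; rewrite ?orbT.
- by apply/subsetP => x; rewrite !inE => /orP[/eqP->|/sLv].
- move=> x y xy /(sP _ _ xy).
  by rewrite !inE; case/or3P => ->; rewrite ?orbT.
- case/and5P: legm => euv _ _ _ _ x y; rewrite in_setU1 => /orP[/eqP[-> ->]|] //.
  exact: sE.
- case/and5P: legm => euv _ su _ _ x y; rewrite in_setU1 => xy.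
  apply: (@in_marked_mono s); first exact: subsetUr.
  by case/orP: xy => [/eqP[-> _]|/sT].
- exact: setSD.
- move=> x y; rewrite !inE; have [->|yv] := eqVneq y v; first by rewrite orbT.
  rewrite xpair_eqE (negPf yv) andbF /= => xy ny.
  have {}ny: ~~ in_marked e s y.
    by apply: contra ny; apply: in_marked_mono; apply: subsetUr.
  by have := sP _ _ xy ny; rewrite !inE.
- exact: subset_trans (subsetDl _ _) sL.
- move=> x y xy /(sP _ _ xy); rewrite !inE; case: eqP => //= ->.
  by rewrite (sLv _ legm).
- move=> x y xy ny; have := sP _ _ xy ny; rewrite !inE.
  (* The non-sink [v] has a marked out-edge [(v, w)], so it was already fully computed. *)
  case: eqP => //= yv; case/and3P: legm => _ /forallPn[w].
  rewrite negbK => vw /forallP/(_ w)/implyP/(_ vw) vwm.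
  by rewrite yv in ny; case/negP: ny; apply: sT vwm.
Qed.

(** * Evolution of a state within one segment *)

Definition newly_marked s t := marked t :\: marked s.

(** The last two fields drive a backward walk outside [D]: [segment_tail] yields a new in-edge of
    the tail, and [segment_head] makes every in-edge marked by [t] new. [segment_red] lets both
    survive a computation. *)
Record segment_inv D s t : Prop := SegmentInv {
  segment_mono : marked s \subset marked t;
  segment_red : forall v, v \in red t -> v \notin D ->
    exists u, (u, v) \in newly_marked s t;
  segment_head : forall u v, (u, v) \in newly_marked s t -> v \notin D ->
    forall w, (w, v) \notin marked s;
  segment_tail : forall u v, (u, v) \in newly_marked s t -> u \notin D ->
    exists w, (w, u) \in newly_marked s t }.

Lemma segment_inv_refl D s : red s \subset D -> segment_inv D s s.
Proof.
move=> /subsetP sD.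
by split=> // [v /sD -> //|u v|u v]; rewrite /newly_marked setDv inE.
Qed.

Definition loaded m := if m is MLoad v then Some v else None.

Lemma segment_inv_move D s t m :
  (forall v, loaded m = Some v -> v \in D) ->
  reachable_inv t -> segment_inv D s t -> legal e t m ->
  segment_inv D s (apply_move t m).
Proof.
move=> mD [_ tT _ tP] [st tR tH tTl].
case: m mD => [v|v|u v|v|v] /= mD legm; split=> //=.
- move=> x; rewrite !inE => xr xD; apply: tR => //.
  by move: xr; rewrite !inE; case: eqP => [->|]; rewrite ?legm ?orbT.
- move=> x; rewrite !inE; have [->|xv] /= := eqVneq x v; first by rewrite mD.
  by move=> xr xD; apply: tR => //; rewrite !inE.
- exact: subset_trans st (subsetUr _ _).
all: try by move=> x xr xD; apply: tR xD; move: xr; rewrite !inE;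
  case: (x == v); rewrite /= ?andbF ?orbF // => ->; rewrite ?orbT.
all: case/and5P: legm => euv uvN tu ur vp.
all: have uvN' : (u, v) \notin marked s by apply: contra uvN; apply: subsetP.
all: have newS x y : (x, y) \in newly_marked s t ->
       (x, y) \in newly_marked s (apply_move t (MCompute u v)).
all: try by rewrite !inE => /andP[-> ->]; rewrite orbT.
- move=> x; rewrite !inE; have [-> _ _|xv] /= := eqVneq x v.
    by exists u; rewrite !inE uvN' eqxx.
  move=> xr xD; have [|y xy] := tR x _ xD; first by rewrite !inE.
  by exists y; apply: newS.
- move=> x y; rewrite in_setD in_setU1 => /andP[xyN] /orP[/eqP[_ ->]|xy]; last first.
    by apply: (tH x); rewrite !inE xyN.
  (* If [v] is red, the segment already marked an in-edge of it. Otherwise [v] carries no pebble; as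
     [(u, v)] is unmarked in [t], [partially_marked] forbids any marked in-edge of [v]. *)
  move=> vD w; case/orP: vp => [vr|vN].
    by have [z zv] := tR v vr vD; apply: (tH z).
  apply: contra vN => /(subsetP st) wv; apply: tP wv _.
  by apply: contra uvN => /in_markedP; apply.
- move=> x y; rewrite in_setD in_setU1 => /andP[xyN] /orP[/eqP[-> _]|xy] xD.
    by have [w wu] := tR u ur xD; exists w; apply: newS.
  have [|w wx] := tTl x y _ xD; first by rewrite !inE xyN.
  by exists w; apply: newS.
Qed.

Definition loads ms := pmap loaded ms.

Lemma size_loads ms : size (loads ms) <= cost ms.
Proof. by elim: ms => //= -[v|v|u v|v|v] ms /=; rewrite /cost /=; lia. Qed.

Lemma segment_inv_moves D r s t ms :
  {subset loads ms <= D} -> reachable_inv t -> segment_inv D s t ->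
  legal_seq e r t ms ->
  reachable_inv (foldl (@apply_move V) t ms) /\
  segment_inv D s (foldl (@apply_move V) t ms).
Proof.
elim: ms t => //= m ms IH t msD tI stI /and3P[_ legm legms]; apply: IH => //.
- by move=> v vms; apply: msD; rewrite /loads /=; case: loaded => //= w;
    rewrite inE vms orbT.
- exact: reachable_inv_move.
- apply: segment_inv_move => // v mv.
  by apply: msD; rewrite /loads /= mv inE eqxx.
Qed.

(** * Completed nodes and their dominators *)

Definition completed s : {set V} :=
  [set v | if is_source e v then [exists w, (v, w) \in marked s]
           else in_marked e s v].

Lemma completed_mono s t :
  marked s \subset marked t -> completed s \subset completed t.
Proof.
move=> st; apply/subsetP => v; rewrite !inE; case: ifP => _.
  by case/existsP => w vw; apply/existsP; exists w; apply: subsetP vw.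
exact: in_marked_mono.
Qed.

(** The edge [(u, v)] is marked, which required [u] to be fully computed; for a source [u], it is
    the required out-edge. *)
Lemma completed_pred s u v :
  reachable_inv s -> e u v -> v \in completed s -> u \in completed s.
Proof.
move=> sI uv; rewrite !inE; case: ifP => [/forallP/(_ u)|_]; first by rewrite uv.
move=> /in_markedP/(_ _ uv) uvm; case: ifP => _; last exact: marked_tail uvm.
by apply/existsP; exists v.
Qed.

(** Sources satisfy [in_marked] vacuously from the start, which is why [completed] tests their
    out-edges instead. *)
Lemma completed_init : completed (init e) = set0.
Proof.
apply/setP => v; rewrite !inE; case: ifPn => [_|].
  by apply/existsP => -[w]; rewrite inE.
case/forallPn => u; rewrite negbK => uv.
by apply/negP => /in_markedP/(_ _ uv); rewrite inE.
Qed.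

Lemma completed_terminal s :
  no_isolated e -> terminal e s -> completed s = setT.
Proof.
move=> isoN [_ sE]; apply/setP => v; rewrite !inE.
case: ifP => [/forallP src|_]; last by apply/in_markedP => u /sE.
have [u [uv|vu]] := isoN v; first by have := src u; rewrite uv.
by apply/existsP; exists u; apply: sE.
Qed.

Lemma segment_dominator D s t : reachable_inv t -> segment_inv D s t ->
  dominator e D (completed t :\: completed s).
Proof.
move=> tI [st _ tH tTl] x p srcx xp; rewrite !inE => /andP[Ns Ct].
have newE u v : (u, v) \in newly_marked s t -> e u v.
  by rewrite inE => /andP[_ /(marked_edge tI)].
have srcD w : (x, w) \in newly_marked s t -> x \in D.
  move=> xw; apply/contraT => /(tTl _ _ xw)[z /newE zx].
  by move/forallP/(_ z): srcx; rewrite zx.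
(* Induction on the path from its end; the new in-edge of the endpoint need not lie on the path. *)
have back : forall u, in_marked e t (last x p) ->
    (u, last x p) \in newly_marked s t -> has (mem D) (x :: p).
  elim/last_ind: p xp {Ns Ct} => [|p v IH].
    by move=> _ u _ /newE ux; move/forallP/(_ u): srcx; rewrite ux.
  rewrite rcons_path last_rcons => /andP[xp lv] u vt uv.
  have [vD|vD] := boolP (v \in D).
    by rewrite -rcons_cons has_rcons /= vD.
  (* No in-edge of [v] was marked at [s] and all are at [t], so the path edge into [v] is new
     too. *)
  have lvN : (last x p, v) \in newly_marked s t.
    by rewrite !inE (tH _ _ uv vD) /=; apply: (in_markedP _ _ vt).
  rewrite -rcons_cons has_rcons; apply/orP; right.
  have [lD|lD] := boolP (last x p \in D).
    by apply/hasP; exists (last x p) => //; apply: mem_last.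
  have [w wl] := tTl _ _ lvN lD; apply: IH wl => //.
  by apply: (marked_tail tI (v := v)); move: lvN; rewrite inE => /andP[].
move: Ns Ct; case: ifPn => [src|_] Ns Ct.
  case/existsP: Ct => w lw.
  have lE : last x p = x.
    case/lastP: p xp src {back Ns lw} => // p v.
    rewrite rcons_path last_rcons => /andP[_ lv] /forallP/(_ (last x p)).
    by rewrite lv.
  rewrite lE in lw Ns; apply/orP; left; apply: (srcD w); rewrite !inE lw andbT.
  by move: Ns; rewrite negb_exists => /forallP.
move: Ns; rewrite negb_forall => /existsP[u]; rewrite negb_imply => /andP[ul uN].
by apply: (back u Ct); rewrite !inE uN; apply: (in_markedP _ _ Ct).
Qed.

Lemma segment_dominator_card r s ms : cost ms <= r -> reachable_inv s ->
  legal_seq e r s ms ->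
  let t := foldl (@apply_move V) s ms in
  [/\ reachable_inv t, marked s \subset marked t &
    exists2 D : {set V}, #|D| <= 2 * r & dominator e D (completed t :\: completed s)].
Proof.
move=> cr sI leg t; pose D := red s :|: [set:: loads ms].
have [||//|tI stI] := @segment_inv_moves D r s s ms _ sI.
- by move=> v vms; rewrite !inE vms orbT.
- by apply: segment_inv_refl; apply: subsetUl.
- split=> //; first exact: segment_mono stI.
  exists D; last exact: segment_dominator.
  have rr : num_red s <= r by case: ms leg {cr t D tI stI} => [|? ?] /andP[].
  have lc : #|[set:: loads ms]| <= cost ms.
    by rewrite cardsE (leq_trans (card_size _)) ?size_loads.
  have := leq_card_setU (red s) [set:: loads ms].
  have := leq_card_setU (light s) (dark s).
  rewrite -/(red s) -/D; move: rr; rewrite /num_red => rr [A _] [B _].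
  move: (#|_|) (#|_|) (#|_|) (#|_|) (#|_|) (cost ms) cr rr lc A B; lia.
Qed.

(** * Assembling the classes of all segments *)

Definition precedes W1 W2 :=
  [disjoint W1 & W2] && [forall u in W2, forall v in W1, ~~ e u v].

(** A dominator partition of the complement of [C] only: with [C] the nodes completed so far, it is
    built from the last segment backwards, until [C] is [set0]. *)
Definition layering (S : nat) (C : {set V}) (Vs : seq {set V}) :=
  [/\ set0 \notin Vs, pairwise precedes Vs,
      forall v, (v \in ~: C) = has (fun W => v \in W) Vs
    & forall W, W \in Vs -> exists2 D : {set V}, #|D| <= S & dominator e D W].

Lemma layering_cons S s t Vs :
  reachable_inv t -> completed s \subset completed t ->
  (exists2 D : {set V}, #|D| <= S & dominator e D (completed t :\: completed s)) ->
  layering S (completed t) Vs ->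
  exists2 Vs', layering S (completed s) Vs' & size Vs' <= (size Vs).+1.
Proof.
move=> tI /subsetP st tD [Vs0 Vsp VsC VsD].
(* A segment that completes no node contributes no class, hence a mere upper bound on the size. *)
have [E|N0] := eqVneq (completed t :\: completed s) set0.
  exists Vs => //; split=> // v; rewrite -VsC !in_setC.
  have := st v; have /setP/(_ v) := E; rewrite in_setD in_set0.
  by case: (v \in completed s); case: (v \in completed t) => //= _ /(_ isT).
exists ((completed t :\: completed s) :: Vs) => //; split.
- by rewrite inE negb_or eq_sym N0.
- rewrite /= Vsp andbT; apply/allP => W WVs.
  have Wt v : v \in W -> v \notin completed t.
    by move=> vW; rewrite -in_setC VsC; apply/hasP; exists W.
  apply/andP; split.
    rewrite disjoint_sym; apply/pred0P => v /=; apply/negbTE.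
    rewrite in_setD; apply/negP => /and3P[/Wt vN _ vt].
    by rewrite vt in vN.
  apply/forallP => u; apply/implyP => /Wt uN.
  apply/forallP => v; apply/implyP; rewrite in_setD => /andP[_ vt].
  by apply: contra uN => uv; apply: completed_pred uv vt.
- move=> v; rewrite /= -VsC in_setD !in_setC.
  have := st v.
  by case: (v \in completed s); case: (v \in completed t) => // /(_ isT).
- by move=> W; rewrite inE => /orP[/eqP->|/VsD].
Qed.

(** Each move adds at most one to the cost, so prefixes attain every value up to the total. *)
Lemma cost_split r ms : r <= cost ms ->
  exists ms1 ms2, ms = ms1 ++ ms2 /\ cost ms1 = r.
Proof.
elim: ms r => [|m ms IH] [|r]; rewrite /cost //=; first by exists [::], [::].
  by exists [::], (m :: ms).
move=> rc; have [|ms1 [ms2 [-> c1]]] := IH (r.+1 - is_io m).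
  by rewrite /cost; lia.
by exists (m :: ms1), ms2; split=> //=; move: c1; rewrite /cost /=; case: is_io; lia.
Qed.

Lemma legal_seq_cat r s ms1 ms2 : legal_seq e r s (ms1 ++ ms2) ->
  legal_seq e r s ms1 /\ legal_seq e r (foldl (@apply_move V) s ms1) ms2.
Proof.
elim: ms1 s => [|m ms1 IH] s /=; first by move=> leg; rewrite leg; case: ms2 leg => [|? ?] /= /andP[->].
by case/and3P => -> -> /IH.
Qed.

Lemma pebbling_layering r s ms : 0 < r -> no_isolated e -> reachable_inv s ->
  legal_seq e r s ms -> terminal e (foldl (@apply_move V) s ms) ->
  exists2 Vs, layering (2 * r) (completed s) Vs & r * (size Vs).-1 <= cost ms.
Proof.
move=> r0 isoN; have [n] := ubnP (cost ms).
elim: n s ms => // n IH s ms cn sI leg term.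
(* The last segment may cost less than [r]; it yields at most one class, the one discounted by
   [.-1]. *)
have [cr|rc] := leqP (cost ms) r.
  have [tI st tD] := segment_dominator_card cr sI leg.
  have [|Vs VsL Vs1] := layering_cons (Vs := [::]) tI (completed_mono st) tD.
    by split=> // v; rewrite (completed_terminal isoN term) !inE.
  by exists Vs => //; case: (size Vs) Vs1 => [|[|?]] //= _; rewrite muln0.
have [ms1 [ms2 [msE c1]]] := cost_split (ltnW rc); rewrite {}msE in cn leg term *.
have [leg1 leg2] := legal_seq_cat leg.
have [|tI st tD] := segment_dominator_card _ sI leg1; first by rewrite c1.
rewrite foldl_cat in term.
have cE : cost (ms1 ++ ms2) = r + cost ms2 by rewrite -c1 /cost count_cat.
have [|Vs2 Vs2L Vs2c] := IH _ _ _ tI leg2 term; first by lia.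
have [Vs VsL VsS] := layering_cons tI (completed_mono st) tD Vs2L.
exists Vs => //; rewrite cE; apply: (@leq_trans (r * (size Vs2).-1.+1)).
  by rewrite leq_mul2l; lia.
by rewrite mulnS leq_add2l.
Qed.

Lemma layering_partition S Vs :
  layering S set0 Vs -> dominator_partition e S Vs.
Proof.
case=> Vs0 Vsp VsC VsD; have /(pairwiseP set0) Vsn := Vsp.
have neq0 i : i < size Vs -> nth set0 Vs i != set0.
  by move=> iVs; apply: contraNneq Vs0 => <-; apply: mem_nth.
have dis i j : i < size Vs -> j < size Vs -> i < j ->
    [disjoint nth set0 Vs i & nth set0 Vs j].
  by move=> iV jV ij; have /andP[] := Vsn i j iV jV ij.
have disN i j : i < size Vs -> j < size Vs -> i != j ->
    [disjoint nth set0 Vs i & nth set0 Vs j].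
  move=> iV jV; rewrite neq_ltn => /orP[]; first exact: dis.
  by rewrite disjoint_sym; apply: dis.
split=> //.
(* Equal classes at distinct positions would be disjoint, hence empty. *)
- apply/(uniqP set0) => i j iV jV ijE; apply/eqP; apply: contraTT isT => ij.
  have := disN i j iV jV ij; rewrite ijE -setI_eq0 setIid.
  by rewrite (negPf (neq0 j jV)).
- apply/and3P; split; last by rewrite inE.
    rewrite eqEsubset subsetT /=; apply/subsetP => v _.
    have: v \in ~: set0 by rewrite !inE.
    rewrite VsC => /hasP[W WV vW]; apply/bigcupP; exists W => //.
    by rewrite inE.
  apply/trivIsetP => A B; rewrite !inE => /(nthP set0)[i iV <-].
  move=> /(nthP set0)[j jV <-] ijN; apply: disN => //.
  by apply: contraNneq ijN => ->.
- move=> i j u v /andP[ji iV] uW vW.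
  have /andP[_ /forall_inP/(_ u uW)/forall_inP/(_ v vW)] // :=
    Vsn j i (ltn_trans ji iV) iV ji.
Qed.

End Pebbling.

(** * Passage to the minima *)

Lemma min_natP (P : nat -> Prop) n : P n ->
  exists2 k, min_nat P = (Posz k)%:E%E & P k /\ k <= n.
Proof.
move=> Pn; rewrite /min_nat; case: pselect => [exP|[]]; last first.
  by exists n; apply/asboolP.
case: ex_minnP => k /asboolP Pk kmin; exists k => //; split=> //.
by apply: kmin; apply/asboolP.
Qed.

Theorem theorem6p7 (V : finType) (e : rel V) (r : nat)
    (e_acyclic : acyclic e) (e_no_isolated : no_isolated e) (r_gt0 : 0 < r) :
  ((r%:Z)%:E * (MIN_dom e (2 * r)%N - 1%:E) <= OPT_PRBP e r)%E.
Proof.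
pose P c := exists2 ms, pebbling e r ms & cost ms = c.
have [[c Pc]|noP] := pselect (exists c, P c); last first.
  suff -> : OPT_PRBP e r = +oo%E by rewrite leey.
  rewrite /OPT_PRBP /min_nat; case: pselect => // exP.
  by case: noP; case: exP => c /asboolP Pc; exists c.
have [k kE [[ms [leg term] ck] _]] := min_natP (P := P) Pc; rewrite /OPT_PRBP kE.
have [Vs VsL Vsc] :=
  pebbling_layering r_gt0 e_no_isolated (reachable_inv_init e) leg term.
rewrite completed_init in VsL.
pose Q c := exists2 Vs, dominator_partition e (2 * r) Vs & size Vs = c.
have [|n nE [_ nVs]] := min_natP (P := Q) (n := size Vs).
  by exists Vs => //; apply: layering_partition.
rewrite /MIN_dom nE -EFinB -EFinM lee_fin.
have: r * n.-1 <= k by rewrite -ck (leq_trans _ Vsc) // leq_mul2l; lia.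
(* For [n = 0], which occurs only when [V] is empty, [n.-1] is truncated, but the left-hand side is
   then [-r]. *)
case: n {nE nVs} => [|n] /=; first by lia.
by rewrite -[n.+1]addn1 PoszD GRing.addrK -PoszM lez_nat.
Qed.
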